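(* Let $l^{(2)}(t)$ and $u^{(2)}(t)$ be functions (values $\pm\infty$ allowed) such that $l^{(2)}(t)\le m^{(2)}_{\lambda}(t)\le u^{(2)}(t)$ for all $\lambda\ge 0$ and any $t$. Let $\xi^{*}(t)=\max\{l^{(2)}(t),\min\{m_{0,2},u^{(2)}(t)\}\}$, $t\in\mathbb{R}$, and let $\delta_{\xi^{*}}(\mathbf{X})=X_2-\xi^{*}(D)$. Let $\delta_{2,PNLEE}(\mathbf{X})=X_2-m_{0,2}$ be the unrestricted Pitman nearest location equivariant estimator of $\theta_2$. If $P_{\boldsymbol\theta}[l^{(2)}(D)\le m_{0,2}\le u^{(2)}(D)]<1$ for all $\boldsymbol\theta\in\Theta_0$, then $GPN(\delta_{\xi^{*}},\delta_{2,PNLEE};\boldsymbol\theta)>\frac12$ for all $\boldsymbol\theta\in\Theta_0$.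
   Context: $f$ is a specified Lebesgue probability density on $\mathbb{R}^2$, and $\mathbf{X}=(X_1,X_2)$ has joint p.d.f. $f(x_1-\theta_1,x_2-\theta_2)$, where $\boldsymbol\theta=(\theta_1,\theta_2)\in\Theta_0=\{(t_1,t_2)\in\mathbb{R}^2: t_1\le t_2\}$ is unknown. Put $\lambda=\theta_2-\theta_1\ge 0$, $D=X_2-X_1$, $Z_2=X_2-\theta_2$; $m_{0,2}$ is the median of $Z_2$. The p.d.f. of $D$ is $f_D(t|\lambda)=\int_{-\infty}^{\infty}f(y-t+\lambda,y)\,dy$, and the conditional p.d.f. of $Z_2$ given $D=t$ is $f_\lambda(s|t)=f(s-t+\lambda,s)/f_D(t|\lambda)$ ($t$ in the support of $D$). $m^{(2)}_\lambda(t)$ denotes the median of this conditional distribution, so $\int_{-\infty}^{m^{(2)}_\lambda(t)}f(s-t+\lambda,s)\,ds=\frac12\int_{-\infty}^{\infty}f(s-t+\lambda,s)\,ds$. General loss function: $L_2(\boldsymbol\theta,a)=W(a-\theta_2)$, $a\in\mathbb{R}$, where $W:\mathbb{R}\to[0,\infty)$ satisfies $W(0)=0$, $W$ strictly decreasing on $(-\infty,0)$ and strictly increasing on $(0,\infty)$. For estimators $\delta_1,\delta_2$ of $\theta_2$, $GPN(\delta_1,\delta_2;\boldsymbol\theta)=P_{\boldsymbol\theta}[L_2(\boldsymbol\theta,\delta_1)<L_2(\boldsymbol\theta,\delta_2)]+\frac12P_{\boldsymbol\theta}[L_2(\boldsymbol\theta,\delta_1)=L_2(\boldsymbol\theta,\delta_2)]$.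 All functions defining estimators are understood to be Borel measurable.
   Formalization: It is additionally assumed that W has a two-sided limit at 0 (not necessarily W(0)); without this the strict inequality can fail (GPN = 1/2 for a W with a jump at 0). The conditional median of Z_2 given D=t is taken to be unique. *)

(* Defs.v *)
(* MathComp world, with MathComp-Analysis. *)
From HB Require Import structures.
From mathcomp Require Import all_boot all_order all_algebra.
From mathcomp Require Import all_classical all_reals all_analysis.
From mathcomp Require Import measurable_realfun.
Set Implicit Arguments.
Unset Strict Implicit.
Unset Printing Implicit Defensive.
Import Order.TTheory GRing.Theory Num.Theory.
Import numFieldNormedType.Exports.
Local Open Scope classical_set_scope.
Local Open Scope ring_scope.

Section Defs.
Context {R : realType}.

Let RB : measurableType _ := measurableTypeR R.
Let mu : {measure set RB -> \bar R} := @lebesgue_measure R.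

(* Points of the plane are pairs: x.1, x.2 are the coordinates x_1, x_2. *)
Definition lebesgue2 : set (RB * RB) -> \bar R :=
  (@lebesgue_measure R \x @lebesgue_measure R)%E.

Definition is_pdf2 (f : RB * RB -> R) : Prop :=
  [/\ measurable_fun setT f,
      forall z, 0 <= f z
    & (\int[lebesgue2]_z (f z)%:E = 1)%E].

Definition Theta0 : set (R * R) := [set theta | theta.1 <= theta.2].

(* P_theta, realized on the sample space R^2 with X the identity map. *)
Definition prob (f : RB * RB -> R) (theta : R * R) (A : set (RB * RB)) : \bar R :=
  (\int[lebesgue2]_(x in A) (f (x.1 - theta.1, x.2 - theta.2)%R)%:E)%E.

Definition D (x : R * R) : R := x.2 - x.1.

(* Z = X - theta has density f whatever theta is, so no theta appears here. *)
Definition law_Z2 (f : RB * RB -> R) (B : set RB) : \bar R :=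
  (\int[lebesgue2]_(z in snd @^-1` B) (f z)%:E)%E.

Definition pdf_D (f : RB * RB -> R) (lambda t : R) : \bar R :=
  (\int[mu]_y (f (y - t + lambda, y)%R)%:E)%E.

(* pdf_D may take the value +oo on a Lebesgue-null set of t; there, as where it
   vanishes, there is no conditional density. *)
Definition supp_D (f : RB * RB -> R) (lambda : R) : set R :=
  [set t | (0 < pdf_D f lambda t < +oo)%E].

Definition cond_pdf_Z2 (f : RB * RB -> R) (lambda t s : R) : R :=
  f (s - t + lambda, s) / fine (pdf_D f lambda t).

Definition cond_law_Z2 (f : RB * RB -> R) (lambda t : R) (B : set RB) : \bar R :=
  (\int[mu]_(s in B) (cond_pdf_Z2 f lambda t s)%:E)%E.

(* Meant for laws having a Lebesgue density, for which the distribution function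
   is continuous and a median is exactly a point where it equals 1/2. *)
Definition is_median (P : set RB -> \bar R) (m : R) : Prop :=
  P [set` `]-oo, m]] = (2^-1)%:E.

Definition is_the_median (P : set RB -> \bar R) (m : R) : Prop :=
  unique (is_median P) m.

(* These conditions allow W(0-) <> W(0+).  Then, e.g. for W x = 2 - exp x if x < 0
   and W x = 1 - exp (- x) if x >= 0, moving an estimator up to the conditional
   median may gain exactly probability 1/2 and not more; the theorem therefore
   also assumes that W has a two-sided limit at 0 (not necessarily W 0). *)
Definition is_loss_profile (W : R -> R) : Prop :=
  [/\ forall x, 0 <= W x,
      W 0 = 0,
      forall x y, x < y -> y < 0 -> W y < W x
    & forall x y, 0 < x -> x < y -> W x < W y].

Definition L2 (W : R -> R) (theta : R * R) (a : R) : R := W (a - theta.2).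

Definition GPN (f : RB * RB -> R) (W : R -> R) (delta1 delta2 : R * R -> R)
    (theta : R * R) : \bar R :=
  (prob f theta [set x | (L2 W theta (delta1 x) < L2 W theta (delta2 x))%R]
   + (2^-1)%:E *
     prob f theta [set x | L2 W theta (delta1 x) = L2 W theta (delta2 x)])%E.

Definition xi_star (l u : R -> \bar R) (m : R) (t : R) : \bar R :=
  maxe (l t) (mine m%:E (u t)).

(* xi (D x) is finite whenever D x lies in supp_D, hence almost surely, in the
   application below; fine only supplies a junk value on a null set. *)
Definition delta_xi (xi : R -> \bar R) (x : R * R) : R := x.2 - fine (xi (D x)).

Definition delta_PNLEE (m : R) (x : R * R) : R := x.2 - m.

End Defs.

(* Main.v *)
(* Slice the plane along D = t.  On a slice where l <= m02 <= u the two estimators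
   coincide and tie.  On any other slice xi_star moves m02 strictly towards the
   conditional median m without passing it; say m02 < c <= m with c = xi_star t.
   Then the new estimator wins as soon as Z_2 >= c, and also on some interval
   ]a, c[, because W has at 0 a two-sided limit, which is smaller than every
   W x with x > 0.  Uniqueness of the median makes the conditional probability of
   Z_2 > a strictly larger than 1/2.  If GPN <= 1/2, the slice-wise gain vanishes
   for almost every t, so almost every slice carrying mass is a tie slice, against
   P [l(D) <= m02 <= u(D)] < 1. *)
Require Import Defs.
From HB Require Import structures.
From mathcomp Require Import all_boot all_order all_algebra.
From mathcomp Require Import all_classical all_reals all_analysis.
From mathcomp Require Import measurable_realfun.
From mathcomp Require Import ring lra.
Set Implicit Arguments.
Unset Strict Implicit.
Unset Printing Implicit Defensive.
Import Order.TTheory GRing.Theory Num.Theory.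
Import numFieldNormedType.Exports.
Local Open Scope classical_set_scope.
Local Open Scope ring_scope.

(** * Changes of variables for Lebesgue measure on the line and the plane *)

Lemma ge0_integral_lebesgue_reflect (R : realType) (c : R) (h : R -> \bar R) :
  measurable_fun [set: measurableTypeR R] h -> (forall x, (0 <= h x)%E) ->
  (\int[@lebesgue_measure R]_x h (c - x)%R = \int[@lebesgue_measure R]_x h x)%E.
Proof.
move=> mh h0.
have mphi : measurable_fun [set: measurableTypeR R]
    ((fun x : R => c - x) : measurableTypeR R -> measurableTypeR R).
  exact: measurable_funB.
pose phi : {mfun measurableTypeR R >-> measurableTypeR R} :=
  HB.pack ((fun x : R => c - x) : measurableTypeR R -> measurableTypeR R)
    (isMeasurableFun.Build _ _ _ _ _ mphi).
transitivity (\int[pushforward (@lebesgue_measure R) phi]_x h x)%E.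
  by rewrite ge0_integral_pushforward.
(* Lebesgue measure is determined by its values on half-open intervals, and reflection preserves
   their length, merely exchanging which end point is included. *)
apply: eq_measure_integral => A mA _; apply/esym.
apply: (@lebesgue_measure_unique R (pushforward (@lebesgue_measure R) phi)) => //.
move=> X /ocitvP[->|[[a b] /= ab ->]].
  by rewrite !measure0.
rewrite lebesgue_measure_itv /= /pushforward /=.
have -> : (fun x : R => c - x) @^-1` `]a, b]%classic = `[c - b, c - a[%classic.
  apply/seteqP; split => x /=; rewrite !in_itv /= => /andP[u v]; lra.
by rewrite lebesgue_measure_itv /= !lte_fin ltrD2l ltrN2 -!EFinB; congr (if _ then _%:E else _); ring.
Qed.

(** A translation is the composite of two reflections. *)
Lemma ge0_integral_lebesgue_shift (R : realType) (c : R) (h : R -> \bar R) :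
  measurable_fun [set: measurableTypeR R] h -> (forall x, (0 <= h x)%E) ->
  (\int[@lebesgue_measure R]_x h (x + c)%R = \int[@lebesgue_measure R]_x h x)%E.
Proof.
move=> mh h0; rewrite -(ge0_integral_lebesgue_reflect c mh h0).
rewrite -[RHS](ge0_integral_lebesgue_reflect 0) //.
  by under [RHS]eq_integral do rewrite sub0r opprK addrC.
by apply: measurableT_comp => //; exact: measurable_funB.
Qed.

(** Change of coordinates to [t = x.2 - x.1] and [s = x.2 - b]. Tonelli reduces it to a reflection
    of the first coordinate, an exchange of the integrals and a translation. *)
Lemma ge0_integral_lebesgue2_diff (R : realType) (b : R) (h : R * R -> \bar R) :
  measurable_fun [set: measurableTypeR R * measurableTypeR R] h ->
  (forall x, (0 <= h x)%E) ->
  (\int[@lebesgue2 R]_x h x =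
   \int[@lebesgue_measure R]_t \int[@lebesgue_measure R]_s
     h (s + b - t, s + b)%R)%E.
Proof.
move=> mh h0.
rewrite /lebesgue2 fubini_tonelli2 // /fubini_G.
transitivity (\int[@lebesgue_measure R]_y \int[@lebesgue_measure R]_t h (y - t, y)%R)%E.
  apply: eq_integral => y _.
  rewrite (ge0_integral_lebesgue_reflect y (h := fun x => h (x, y))) //.
  exact: measurable_fun_pair1.
rewrite (fubini_tonelli (fun z : measurableTypeR R * measurableTypeR R => h (z.1 - z.2, z.1)%R)) //=.
  apply: eq_integral => t _.
  rewrite (ge0_integral_lebesgue_shift b (h := fun y => h (y - t, y)%R)) //.
  apply: measurableT_comp => //; apply: measurable_fun_pair => //.
  exact: measurable_funB.
apply: measurableT_comp => //; apply: measurable_fun_pair => //.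
exact: measurable_funB.
Qed.

(** * Comparison of losses and measurability of the loss profile *)

Lemma loss_profile_lt_near (R : realType) (W : R -> R) (m c : R) :
  is_loss_profile W -> cvg (W x @[x --> 0^']) -> m < c ->
  exists2 a, a < c & forall s, a < s -> W (s - c) < W (s - m).
Proof.
move=> [W0 W00 Wd Wi] /cvg_ex[L /cvgrPdist_lt cvgL] mc.
have near0 e : 0 < e -> exists2 d, 0 < d &
    forall x, x != 0 -> `|x| < d -> `|L - W x| < e.
  move=> /cvgL; rewrite near_withinE => /nbhs_ballP[d /= d0 Hd].
  exists d => // x x0 xd; apply: Hd => //.
  by rewrite /ball /= sub0r normrN.
set k := (c - m) / 2.
have k0 : 0 < k by rewrite divr_gt0 // subr_gt0.
(* Otherwise [W (k / 2)] would lie below [L], and by monotonicity [W] would stay at most [W (k / 2)]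
   on ]0, k/2], so its limit from the right could not be [L]. *)
have LWk : L < W k.
  rewrite ltNge; apply/negP => WkL.
  have := Wi (k / 2) k ltac:(lra) ltac:(lra); rewrite -subr_gt0.
  move=> /near0[d d0 Hd].
  set x := Num.min (d / 2) (k / 2).
  have x0 : 0 < x by rewrite lt_min; apply/andP; split; lra.
  have xd : x < d by rewrite gt_min; apply/orP; left; lra.
  have xk : x <= k / 2 by rewrite ge_min lexx orbT.
  have Wx : W x <= W (k / 2).
    move: xk; rewrite le_eqVlt => /orP[/eqP -> //|xk]; exact/ltW/Wi.
  have := Hd x (lt0r_neq0 x0); rewrite gtr0_norm // => /(_ xd).
  rewrite ltr_norml => /andP[_]; lra.
have [d d0 Hd] := near0 (W k - L) ltac:(lra).
(* For [s] below [c], the bound [d] keeps [W (s - c)] close to [L], hence below [W k]; the bound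
   [k], half the gap between [m] and [c], gives [s - m > k]. *)
exists (c - Num.min d k) => [|s].
  by rewrite ltrBlDr ltrDl lt_min d0 k0.
rewrite ltrBlDr -ltrBlDl lt_min => /andP[sd sk].
(* From [c] on, both arguments are nonnegative and monotonicity suffices; [s = c] is treated apart
   because [W] is increasing only on the open half-line. *)
have [cs|sc] := leP c s.
  have [->|neq] := eqVneq s c; last by apply: Wi; [rewrite subr_gt0 lt_neqAle eq_sym neq|lra].
  rewrite subrr W00; apply: (le_lt_trans (W0 ((c - m) / 2))); apply: Wi; lra.
have Wsm : W k < W (s - m) by apply: Wi => //; move: sk; rewrite /k; lra.
apply: lt_trans Wsm.
have := Hd (s - c); rewrite subr_eq0 lt_eqF // ltr0_norm ?subr_lt0 // opprB => /(_ isT sd).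
rewrite ltr_norml => /andP[]; lra.
Qed.

Lemma loss_profile_opp (R : realType) (W : R -> R) :
  is_loss_profile W -> is_loss_profile (W \o -%R).
Proof.
move=> [W0 W00 Wd Wi]; split => [x||x y xy y0|x y x0 xy] /=.
- exact: W0.
- by rewrite oppr0.
- by apply: Wi; lra.
- by apply: Wd; lra.
Qed.

(** Follows from [loss_profile_lt_near] for the reflected profile [W \o -%R] at [- m] and [- c],
    since reflection preserves a two-sided limit at 0. *)
Lemma loss_profile_gt_near (R : realType) (W : R -> R) (m c : R) :
  is_loss_profile W -> cvg (W x @[x --> 0^']) -> c < m ->
  exists2 a, c < a & forall s, s < a -> W (s - c) < W (s - m).
Proof.
move=> hW cW cm.
have cW' : cvg ((W \o -%R) x @[x --> 0^']).
  move: cW => /cvg_ex[L LW]; apply/cvg_ex; exists L.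
  apply/cvgrPdist_lt => e e0; move/cvgrPdist_lt: LW => /(_ e e0).
  rewrite !near_withinE => /nbhs_ballP[d /= d0 Hd].
  apply/nbhs_ballP; exists d => // x; rewrite /ball /= sub0r normrN => xd x0.
  by apply: Hd; rewrite ?oppr_eq0 // /ball /= sub0r opprK.
have [a ac Ha] := loss_profile_lt_near (loss_profile_opp hW) cW' (m := - m) (c := - c) ltac:(lra).
exists (- a) => [|s sa]; first lra.
by have := Ha (- s) ltac:(lra); rewrite /= !opprB !opprK ![- _ + s]addrC.
Qed.

(** Each set where [W < r] is an interval, because [W] falls before 0, vanishes there and rises
    after it. *)
Lemma loss_profile_measurable (R : realType) (W : R -> R) :
  is_loss_profile W -> measurable_fun [set: measurableTypeR R] W.
Proof.
move=> [W0 W00 Wd Wi] mT.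
apply: (measurability _ (RGenInftyO.measurableE R)) => //= _ [_ [r ->] <-].
rewrite setTI; apply: is_interval_measurable => x z /= ; rewrite !in_itv /= => xr zr y.
move=> /andP[]; rewrite le_eqVlt => /predU1P[<- //|xy].
rewrite le_eqVlt => /predU1P[-> //|yz]; rewrite in_itv /=.
have [y0|y0|->] := ltgtP y 0.
- exact: lt_trans (Wd _ _ xy y0) xr.
- exact: lt_trans (Wi _ _ y0 yz) zr.
- by rewrite W00; apply: le_lt_trans (W0 _) xr.
Qed.

(** * Almost everywhere equality, and tails at a unique median *)

Lemma ae_eq_of_integral_le d (T : measurableType d) (R : realType)
    (mu : {measure set T -> \bar R}) (G H : T -> \bar R) :
  measurable_fun setT G -> measurable_fun setT H ->
  (forall x, (0 <= G x)%E) -> (forall x, (0 <= H x)%E) ->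
  {ae mu, forall x, (H x <= G x)%E} ->
  (\int[mu]_x H x < +oo)%E -> (\int[mu]_x G x <= \int[mu]_x H x)%E ->
  {ae mu, forall x, G x = H x}.
Proof.
move=> mG mH G0 H0 HG Hoo GH.
have iH : mu.-integrable setT H.
  apply/integrableP; split => //; congr (_ < _)%E : Hoo.
  by apply: eq_integral => x _; rewrite gee0_abs.
have iG : mu.-integrable setT G.
  apply/integrableP; split => //; congr (_ < _)%E : (le_lt_trans GH Hoo).
  by apply: eq_integral => x _; rewrite gee0_abs.
(* Finiteness almost everywhere makes the extended-real difference [G - H] meaningful; it is
   nonnegative with integral at most 0, hence null. *)
have fG := integrable_ae measurableT iG.
have fH := integrable_ae measurableT iH.
have mGH : measurable_fun setT (G \- H)%E by exact: emeasurable_funB.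
have /(ae_eq_integral_abs _ measurableT mGH) : (\int[mu]_x `|(G \- H) x| = 0)%E.
  apply/eqP; rewrite eq_le integral_ge0 ?andbT //.
  rewrite (ae_eq_integral (G \- H)%E) //; first last.
  - apply: filterS3 HG fG fH => x HGx /(_ I) fGx /(_ I) fHx _.
    by rewrite gee0_abs //= sube_ge0 ?fHx //.
  - exact: measurableT_comp.
  by rewrite integralB // lee_subel_addl // adde0.
move=> GH0; apply: filterS3 GH0 fG fH => x /(_ I) /= + /(_ I) fGx /(_ I) fHx.
by move=> /eqP; rewrite sube_eq ?add0e ?fin_num_adde_defl // => /eqP.
Qed.

(** A point other than [m] where the distribution function equals 1/2 would be a second median, so
    that function is strictly below 1/2 before [m] and strictly above it after. *)
Lemma unique_median_tails (R : realType) (g : R -> R) (m : R) :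
  let P B := (\int[@lebesgue_measure R]_(s in B) (g s)%:E)%E in
  measurable_fun [set: measurableTypeR R] g -> (forall s, 0 <= g s) ->
  P setT = 1%E -> is_the_median P m ->
  (forall a, a < m -> ((2^-1)%:E < P [set` `]a, +oo[])%E) /\
  (forall a, m < a -> ((2^-1)%:E < P [set` `]-oo, a[])%E).
Proof.
move=> P mg g0 PT [Pm um].
have mgE (B : set (measurableTypeR R)) : measurable_fun B (EFin \o g).
  by apply/measurable_EFinP; exact: measurable_funTS.
have leP (A B : set (measurableTypeR R)) :
    measurable A -> measurable B -> A `<=` B -> (P A <= P B)%E.
  by move=> mA mB AB; apply: ge0_subset_integral => // x _; rewrite lee_fin.
have ltm a b : a < b -> is_median P a \/ is_median P b -> P [set` `]-oo, a]] != P [set` `]-oo, b]].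
  move=> ab Pab; apply/eqP => E.
  have [Pa Pb] : is_median P a /\ is_median P b.
    by case: Pab => Pab; split => //; rewrite /is_median ?E // -E.
  by move: ab; rewrite -(um _ Pa) -(um _ Pb) ltxx.
have mono a b : a < b -> (P [set` `]-oo, a]] <= P [set` `]-oo, b]])%E.
  move=> ab; apply: leP => // x; rewrite /= !in_itv /= => /le_trans; apply; exact: ltW.
split=> a am.
  have Pa : (P [set` `]-oo, a]] < (2^-1)%:E)%E.
    by rewrite -Pm lt_neqAle mono // ltm //; right.
  have : P setT = (P [set` `]-oo, a]] + P [set` `]a, +oo[])%E.
    rewrite -(setvU [set` `]-oo, a]]) setCitvl setUC /P.
    rewrite ge0_integral_setU // => [x _|]; first by rewrite lee_fin.
    apply/disj_setPS => x [] /=; rewrite !in_itv /= andbT => xa.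
    by rewrite ltNge xa.
  rewrite PT; have : (0 <= P [set` `]-oo, a]])%E.
    by apply: integral_ge0 => x _; rewrite lee_fin.
  case: (P [set` `]-oo, a]]) Pa => // p; rewrite lte_fin => p2 _.
  case: (P [set` `]a, +oo[]) => [q|_|//]; last by rewrite ltry.
  by rewrite -EFinD => -[?]; rewrite lte_fin; lra.
(* This tail is an open ray while [is_median] speaks of closed ones; the closed ray up to the
   midpoint fits inside it. *)
have mb : m < (m + a) / 2 by lra.
apply: (@lt_le_trans _ _ (P [set` `]-oo, (m + a) / 2]])).
  by rewrite -Pm lt_neqAle mono // ltm //; left.
apply: leP => // x; rewrite /= !in_itv /=; lra.
Qed.

(** * Disintegration of the plane along the lines [D = t] *)

Section slices.
Context (R : realType) (f : measurableTypeR R * measurableTypeR R -> R).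
Hypotheses (mf : measurable_fun setT f) (f0 : forall z, 0 <= f z).
Local Notation mu := (@lebesgue_measure R).

(* The unnormalized conditional mass of the event X \in A on the line D = t,
   parametrized by s = x.2 - theta.2. *)
Definition slice (theta : R * R) (A : set (R * R)) (t : R) : \bar R :=
  (\int[mu]_(s in [set s | A (s + theta.2 - t, s + theta.2)%R])
     (f (s - t + (theta.2 - theta.1), s)%R)%:E)%E.

(** Extending the restricted density by zero turns a slice into an inner integral over the whole
    line, the form that Tonelli handles. *)
Let sliceE theta A t : slice theta A t =
  (\int[mu]_s ((fun x : R * R => (f (x.1 - theta.1, x.2 - theta.2)%R)%:E) \_ A)
     (s + theta.2 - t, s + theta.2)%R)%E.
Proof.
rewrite /slice integral_mkcond; apply: eq_integral => s _.
rewrite !patchE; congr (if _ then _ else _); last first.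
  by rewrite /= addrK; congr (f (_, _))%:E; ring.

Qed.

Let measurable_density theta (A : set (measurableTypeR R * measurableTypeR R)) :
  measurable A -> measurable_fun [set: measurableTypeR R * measurableTypeR R]
  ((fun x => (f (x.1 - theta.1, x.2 - theta.2)%R)%:E) \_ A).
Proof.
move=> mA; apply/(measurable_restrictT _ mA)/measurable_funTS/measurable_EFinP.
apply: measurableT_comp => //; apply: measurable_fun_pair; exact: measurable_funB.
Qed.

Lemma slice_ge0 theta A t : (0 <= slice theta A t)%E.
Proof. by apply: integral_ge0 => s _; rewrite lee_fin. Qed.

Lemma sliceT theta t : slice theta setT t = pdf_D f (theta.2 - theta.1) t.
Proof. by rewrite /slice /pdf_D. Qed.

Lemma measurable_slice theta (A : set (measurableTypeR R * measurableTypeR R)) :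
  measurable A -> measurable_fun [set: measurableTypeR R] (slice theta A).
Proof.
move=> mA; rewrite (funext (sliceE theta A)).
apply: (measurable_fun_fubini_tonelli_F (m2 := mu)
  (fun z : measurableTypeR R * measurableTypeR R =>
   ((fun x : R * R => (f (x.1 - theta.1, x.2 - theta.2)%R)%:E) \_ A)
     (z.2 + theta.2 - z.1, z.2 + theta.2)%R)).
  apply: measurableT_comp; first exact: measurable_density.
  apply: measurable_fun_pair; last exact: measurable_funD.
  by apply: measurable_funB => //; exact: measurable_funD.
by move=> x; apply: erestrict_ge0 => y _; rewrite lee_fin.
Qed.

Lemma prob_slice theta (A : set (measurableTypeR R * measurableTypeR R)) :
  measurable A -> prob f theta A = (\int[mu]_t slice theta A t)%E.
Proof.
move=> mA; rewrite /prob integral_mkcond.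
rewrite (ge0_integral_lebesgue2_diff theta.2).
- by apply: eq_integral => t _; rewrite sliceE.
- exact: measurable_density.
- by move=> x; apply: erestrict_ge0 => y _; rewrite lee_fin.
Qed.

Lemma measurable_pdf_D lambda : measurable_fun [set: measurableTypeR R] (pdf_D f lambda).
Proof.
have := measurable_slice (0, lambda) measurableT.
by rewrite (funext (sliceT (0, lambda))) /= subr0.
Qed.

Lemma pdf_D_ge0 lambda t : (0 <= pdf_D f lambda t)%E.
Proof. by apply: integral_ge0 => s _; rewrite lee_fin. Qed.

Lemma integral_pdf_D lambda : (\int[mu]_t pdf_D f lambda t = \int[@lebesgue2 R]_z (f z)%:E)%E.
Proof.
rewrite (ge0_integral_lebesgue2_diff 0); last by move=> x; rewrite lee_fin.
  (* Replacing [t] by [t + lambda] cancels the offset in [pdf_D], which matches the coordinates with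
     [b = 0]. *)
  rewrite -(ge0_integral_lebesgue_shift lambda (measurable_pdf_D lambda)) => [|t].
    apply: eq_integral => t _; apply: eq_integral => s _.
    by congr (f (_, _))%:E; [ring|rewrite addr0].
  exact: pdf_D_ge0.
exact/measurable_EFinP.
Qed.

Lemma cond_law_Z2E lambda t (B : set (measurableTypeR R)) : measurable B ->
  cond_law_Z2 f lambda t B =
  (\int[mu]_(s in B) (f (s - t + lambda, s)%R)%:E * (fine (pdf_D f lambda t))^-1%:E)%E.
Proof.
move=> mB; rewrite /cond_law_Z2 -ge0_integralZr //.
- apply/measurable_funTS/measurable_EFinP/measurableT_comp => //.
  by apply: measurable_fun_pair => //; apply: measurable_funD => //; exact: measurable_funB.
- by move=> s _; rewrite lee_fin.
- by rewrite lee_fin invr_ge0 fine_ge0 // pdf_D_ge0.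
Qed.

(** Multiplying by [pdf_D], positive and finite on [supp_D], clears the normalization, so that
    conditional tails become comparable with slices. *)
Lemma supp_D_median_tails lambda t m :
  supp_D f lambda t -> is_the_median (cond_law_Z2 f lambda t) m ->
  let tail B := (\int[mu]_(s in B) (f (s - t + lambda, s)%R)%:E)%E in
  (forall a, a < m -> ((2^-1)%:E * pdf_D f lambda t < tail [set` `]a, +oo[])%E) /\
  (forall a, m < a -> ((2^-1)%:E * pdf_D f lambda t < tail [set` `]-oo, a[])%E).
Proof.
move=> /andP[I0 Ioo] hm tail.
have fI : pdf_D f lambda t \is a fin_num by rewrite ge0_fin_numE // pdf_D_ge0.
have fI0 : 0 < fine (pdf_D f lambda t) by rewrite fine_gt0 // I0.
have /= := @unique_median_tails R (cond_pdf_Z2 f lambda t) m.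
case.
- apply: measurable_funM => //; apply: measurableT_comp => //.
  by apply: measurable_fun_pair => //; apply: measurable_funD => //; exact: measurable_funB.
- by move=> s; rewrite divr_ge0 // ltW.
- rewrite -/(cond_law_Z2 _ _ _ _) cond_law_Z2E // -/(pdf_D f lambda t).
  by rewrite -[in X in (X * _)%E](fineK fI) -EFinM divff // gt_eqF.
- exact: hm.
move=> tr tl; split=> a am; rewrite -[in X in (_ * X)%E](fineK fI) -lte_pdivlMr //.
  by rewrite -cond_law_Z2E //; exact: tr.
by rewrite -cond_law_Z2E //; exact: tl.
Qed.

End slices.

(** * Losses of the two estimators along a slice, and measurability of their comparison *)

Section estimators.
Context (R : realType) (W : R -> R) (m0 : R) (xi : R -> \bar R) (theta : R * R).
Hypothesis mW : measurable_fun [set: measurableTypeR R] W.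
Hypothesis mxi : measurable_fun [set: R] xi.

(** Makes [xi (D x)] constant on a slice, so that both losses there depend on [s] alone. *)
Lemma D_slice (t s b : R) : D (s + b - t, s + b) = t.
Proof. by rewrite /D /=; ring. Qed.

Lemma L2_delta_xi_slice t s :
  L2 W theta (delta_xi xi (s + theta.2 - t, s + theta.2)) = W (s - fine (xi t)).
Proof. by rewrite /L2 /delta_xi D_slice /=; congr W; ring. Qed.

Lemma L2_delta_PNLEE_slice t s :
  L2 W theta (delta_PNLEE m0 (s + theta.2 - t, s + theta.2)) = W (s - m0).
Proof. by rewrite /L2 /delta_PNLEE /=; congr W; ring. Qed.

Lemma measurable_D : measurable_fun [set: measurableTypeR R * measurableTypeR R]
  (@D R : _ -> measurableTypeR R).
Proof. exact: measurable_funB. Qed.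

Lemma measurable_L2_delta_xi :
  measurable_fun [set: measurableTypeR R * measurableTypeR R]
    (fun x => L2 W theta (delta_xi xi x)).
Proof.
rewrite /L2 /delta_xi; apply: (measurableT_comp (f := W)) => //.
apply: measurable_funB => //; apply: measurable_funB => //.
apply: (measurableT_comp (f := fine)); first exact: fine_measurable.
apply: (measurableT_comp (f := xi)) => //; exact: measurable_D.
Qed.

Lemma measurable_L2_delta_PNLEE :
  measurable_fun [set: measurableTypeR R * measurableTypeR R]
    (fun x => L2 W theta (delta_PNLEE m0 x)).
Proof.
rewrite /L2 /delta_PNLEE; apply: (measurableT_comp (f := W)) => //.
by apply: measurable_funB => //; exact: measurable_funB.
Qed.

Lemma measurable_win : measurable ([set x |
  L2 W theta (delta_xi xi x) < L2 W theta (delta_PNLEE m0 x)] : set (measurableTypeR R * measurableTypeR R)).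
Proof.
rewrite -[X in measurable X]setTI.
exact: (measurable_fun_ltr measurable_L2_delta_xi measurable_L2_delta_PNLEE measurableT (Y := [set true])).
Qed.

Lemma measurable_tie : measurable ([set x |
  L2 W theta (delta_xi xi x) = L2 W theta (delta_PNLEE m0 x)] : set (measurableTypeR R * measurableTypeR R)).
Proof.
have := measurable_fun_eqr measurable_L2_delta_xi measurable_L2_delta_PNLEE measurableT (Y := [set true]) ltac:(by []).
rewrite setTI; congr measurable; apply/seteqP; split=> x /= /eqP //.
Qed.

End estimators.

(** * Position of the clipped value relative to the median *)

Lemma xi_star_id (R : realType) (l u : R -> \bar R) (m t : R) :
  (l t <= m%:E <= u t)%E -> xi_star l u m t = m%:E.
Proof. by case/andP => lm mu; rewrite /xi_star (min_idPl mu) (max_idPr lm). Qed.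

(** Clipping returns [l t] if [m0] is too small and [u t] if it is too large. The bound returned
    lies between the reals [m0] and [m], so it is finite and [fine] loses nothing. *)
Lemma xi_star_towards (R : realType) (l u : R -> \bar R) (m0 m t : R) :
  (l t <= m%:E <= u t)%E -> ~~ (l t <= m0%:E <= u t)%E ->
  m0 < fine (xi_star l u m0 t) <= m \/ m <= fine (xi_star l u m0 t) < m0.
Proof.
rewrite /xi_star => /andP[lm mu]; rewrite negb_and -!ltNge => /orP[m0l|um0]; [left|right].
  rewrite (min_idPl (ltW (lt_le_trans m0l (le_trans lm mu)))) (max_idPl (ltW m0l)).
  by case: (l t) lm m0l => // r; rewrite !lee_fin !lte_fin /= => -> ->.
rewrite (min_idPr (ltW um0)) (max_idPr (le_trans lm mu)).
by case: (u t) mu um0 => // r; rewrite !lee_fin !lte_fin /= => -> ->.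
Qed.

Lemma measurable_xi_star (R : realType) (l u : R -> \bar R) (m : R) :
  measurable_fun [set: R] l -> measurable_fun [set: R] u ->
  measurable_fun [set: R] (xi_star l u m).
Proof. by move=> ml mu; apply: measurable_maxe => //; exact: measurable_mine. Qed.

(** * Gain of the modified estimator on a single slice *)

Section gain.
Context (R : realType) (f : measurableTypeR R * measurableTypeR R -> R) (W : R -> R).
Hypotheses (mf : measurable_fun setT f) (f0 : forall z, 0 <= f z).
Hypotheses (hW : is_loss_profile W) (hW0 : cvg (W x @[x --> 0^'])).
Context (m0 : R) (l u : R -> \bar R) (theta : R * R).
Local Notation lambda := (theta.2 - theta.1).
Local Notation xi := (xi_star l u m0).
Local Notation win := [set x | L2 W theta (delta_xi xi x) < L2 W theta (delta_PNLEE m0 x)].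
Local Notation tie := [set x | L2 W theta (delta_xi xi x) = L2 W theta (delta_PNLEE m0 x)].

(** Serves to bound the winning mass from below by the mass of a ray, where the tail estimates
    apply. *)
Lemma slice_subset A B (t : R) :
  measurable A -> measurable (B : set (measurableTypeR R * measurableTypeR R)) ->
  A `<=` [set s | B (s + theta.2 - t, s + theta.2)] ->
  (\int[@lebesgue_measure R]_(s in A) (f (s - t + lambda, s)%R)%:E <= slice f theta B t)%E.
Proof.
move=> mA mB AB; apply: ge0_subset_integral => //.
- rewrite -[X in measurable X]setTI.
  apply: (measurable_fun_pair _ _ measurableT) => //; last exact: measurable_funD.
  by apply: measurable_funB => //; exact: measurable_funD.
- apply/measurable_funTS/measurable_EFinP/measurableT_comp => //.
  by apply: measurable_fun_pair => //; apply: measurable_funD => //; exact: measurable_funB.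
- by move=> s _; rewrite lee_fin.
Qed.

(** The winning ray starts at a point [a] strictly beyond the clipped value, on the side away from
    [m]. This is what gives strictness when the clipped value is [m] itself, since a ray starting at
    [m] has only half the mass. *)
Lemma slice_gain t m : measurable_fun [set: R] l -> measurable_fun [set: R] u ->
  supp_D f lambda t -> is_the_median (cond_law_Z2 f lambda t) m ->
  (l t <= m%:E <= u t)%E -> ~~ (l t <= m0%:E <= u t)%E ->
  ((2^-1)%:E * pdf_D f lambda t < slice f theta win t)%E.
Proof.
move=> ml mu st hm lmu lm0u.
have mwin := measurable_win m0 theta (loss_profile_measurable hW)
  (measurable_xi_star m0 ml mu).
have [tailr taill] := supp_D_median_tails mf f0 st hm.
have [/andP[mc cm]|/andP[mc cm]] := xi_star_towards lmu lm0u.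
  have [a ac Ha] := loss_profile_lt_near hW hW0 mc.
  apply: (lt_le_trans (tailr a (lt_le_trans ac cm))).
  apply: slice_subset => // s /=; rewrite in_itv /= andbT => /Ha.
  by rewrite L2_delta_xi_slice L2_delta_PNLEE_slice.
have [a ac Ha] := loss_profile_gt_near hW hW0 cm.
apply: (lt_le_trans (taill a (le_lt_trans mc ac))).
apply: slice_subset => // s /=; rewrite in_itv /= => /Ha.
by rewrite L2_delta_xi_slice L2_delta_PNLEE_slice.
Qed.

Lemma slice_tie t : (l t <= m0%:E <= u t)%E -> slice f theta tie t = pdf_D f lambda t.
Proof.
move=> lm0u; rewrite /slice /pdf_D; congr integral; apply/seteqP; split=> s //= _.
by rewrite L2_delta_xi_slice L2_delta_PNLEE_slice xi_star_id.
Qed.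

End gain.

Theorem corollary3p2p2 (R : realType)
  (f : measurableTypeR R * measurableTypeR R -> R)
  (W : R -> R) (m02 : R) (m2 : R -> R -> R)
  (l u : R -> \bar R)
  (hf : is_pdf2 f)
  (hW : is_loss_profile W)
  (hW0 : cvg (W x @[x --> 0^']))
  (hm02 : is_median (law_Z2 f) m02)
  (hm2 : forall lambda t : R, 0 <= lambda -> supp_D f lambda t ->
    is_the_median (cond_law_Z2 f lambda t) (m2 lambda t))
  (hl : measurable_fun [set: R] l)
  (hu : measurable_fun [set: R] u)
  (hlu : forall lambda t : R, 0 <= lambda -> supp_D f lambda t ->
    (l t <= (m2 lambda t)%:E <= u t)%E)
  (hP : forall theta, Theta0 theta ->
    (prob f theta [set x | l (D x) <= m02%:E <= u (D x)] < 1)%E) :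
  forall theta, Theta0 theta ->
    ((2^-1)%:E < GPN f W (delta_xi (xi_star l u m02)) (delta_PNLEE m02) theta)%E.
Proof.
move=> theta Htheta; have [mf f0 f1] := hf.
have lambda0 : 0 <= theta.2 - theta.1 by rewrite subr_ge0.
set lambda := theta.2 - theta.1 in lambda0.
have mxi := measurable_xi_star m02 hl hu.
have mW := loss_profile_measurable hW.
have mwin := measurable_win m02 theta mW mxi.
have mtie := measurable_tie m02 theta mW mxi.
rewrite /GPN; set win := [set x | (_ < _)%R] in mwin *; set tie := [set x | _ = _] in mtie *.
set good := [set x : R * R | (l (D x) <= m02%:E <= u (D x))%E].
have mgood : measurable (good : set (measurableTypeR R * measurableTypeR R)).
  rewrite (_ : good = [set x | (l (D x) <= m02%:E)%E] `&` [set x | (m02%:E <= u (D x))%E]).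
    apply: measurableI; rewrite -[X in measurable X]setTI; apply: measurable_lee => //.
    - exact: (measurableT_comp hl (@measurable_D R)).
    - exact: (measurableT_comp hu (@measurable_D R)).
  by apply/seteqP; split=> x /= /andP.
(* [G] is the contribution of the slice to [GPN] and [H] is half its mass; their integrals are [GPN]
   and 1/2. *)
pose G t := (slice f theta win t + (2^-1)%:E * slice f theta tie t)%E.
pose H t := ((2^-1)%:E * pdf_D f lambda t)%E.
have mp := measurable_pdf_D mf f0 lambda.
have p0 t := pdf_D_ge0 f0 lambda t.
have s0 A t := slice_ge0 f0 theta A t.
have ip : (\int[@lebesgue_measure R]_t pdf_D f lambda t = 1)%E.
  by rewrite integral_pdf_D.
have ms A mA := @measurable_slice R f mf f0 theta A mA.
have [msw mst msg] := And3 (ms _ mwin) (ms _ mtie) (ms _ mgood).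
have iH : (\int[@lebesgue_measure R]_t H t = (2^-1)%:E)%E.
  by rewrite /H ge0_integralZl // ip mule1.
have -> : (prob f theta win + (2^-1)%:E * prob f theta tie =
           \int[@lebesgue_measure R]_t G t)%E.
  rewrite !prob_slice // /G [RHS]ge0_integralD //; first by rewrite ge0_integralZl.
    by move=> t _; rewrite mule_ge0.
  exact: measurable_funeM.
have good_tie t : (l t <= m02%:E <= u t)%E -> (H t <= G t)%E.
  by move=> lt; rewrite /G slice_tie // leeDr.
have bad_win t : supp_D f lambda t -> ~~ (l t <= m02%:E <= u t)%E -> (H t < G t)%E.
  move=> st nlt; apply: (@lt_le_trans _ _ (slice f theta win t)); last first.
    by rewrite leeDl // mule_ge0.
  exact: (slice_gain mf f0 hW hW0 hl hu st (hm2 _ _ lambda0 st) (hlu _ _ lambda0 st)).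
(* A slice outside [supp_D] has mass 0 or infinite mass; [fin_p] below rules out the latter almost
   everywhere. *)
have null t : (pdf_D f lambda t < +oo)%E -> ~ supp_D f lambda t ->
    pdf_D f lambda t = 0%E.
  move=> poo st; apply/eqP; rewrite eq_le p0 andbT leNgt; apply/negP => ppos.
  by apply: st; rewrite /supp_D /= ppos.
have aeF : Filter (almost_everywhere (@lebesgue_measure R)) by exact: ae_filter_ringOfSetsType.
have fin_p : {ae @lebesgue_measure R, forall t, (pdf_D f lambda t < +oo)%E}.
  have : (@lebesgue_measure R).-integrable setT (pdf_D f lambda).
    apply/integrableP; split => //.
    by under eq_integral do rewrite gee0_abs //; rewrite ip ltry.
  by move/(integrable_ae measurableT); apply: filterS => t /(_ I); rewrite ge0_fin_numE.
rewrite ltNge; apply/negP => GH.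
(* [H <= G] holds almost everywhere, whereas the assumption [GH] says that the integral of [G] does
   not exceed that of [H]. *)
have GHae : {ae @lebesgue_measure R, forall t, G t = H t}.
  apply: (ae_eq_of_integral_le (mu := @lebesgue_measure R)).
  - by apply: emeasurable_funD => //; exact: measurable_funeM.
  - exact: measurable_funeM.
  - by move=> t; rewrite adde_ge0 // mule_ge0.
  - by move=> t; rewrite mule_ge0.
  - apply: filterS fin_p => t poo.
    have [/good_tie //|bad] := boolP (l t <= m02%:E <= u t)%E.
    have [/bad_win/(_ bad)/ltW //|ns] := pselect (supp_D f lambda t).
    by rewrite /H null // mule0 adde_ge0 // mule_ge0.
  - by rewrite iH ltry.
  - by rewrite iH.
suff good1 : prob f theta good = 1%E by have := hP _ Htheta; rewrite good1 ltxx.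
(* Slices of [good] are compared with [pdf_D]: they are full lines where [l t <= m02 <= u t] and
   empty elsewhere. In the empty case [t] is outside [supp_D], as a strict gain would contradict
   [G t = H t], so [pdf_D] vanishes too. *)
rewrite prob_slice // -ip; apply: ge0_ae_eq_integral => //.
apply: filterS2 fin_p GHae => t poo GHt _.
have [lt|bad] := boolP (l t <= m02%:E <= u t)%E.
  by rewrite /slice /pdf_D; congr integral; apply/seteqP; split=> s //= _; rewrite /good /= D_slice.
have [/bad_win/(_ bad)|ns] := pselect (supp_D f lambda t); first by rewrite GHt ltxx.
rewrite null // /slice (_ : [set s | _] = set0) ?integral_set0 //.
by apply/seteqP; split=> s //=; rewrite /good /= D_slice (negbTE bad).
Qed.
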